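(* Let $k$ be a field, let $K$ be a simplicial complex on the vertex set $[m]$, and fix $I,J\subseteq[m]$. Let $s\geqslant1$ and suppose that $d_r=0$ for $1\leqslant r<s$ in the augmented Mayer--Vietoris spectral sequence $(E_r^{p,q},d_r)$ associated to $\mathcal{U}_{I,J}=\{K_{J\smallsetminus i}: i\in I\cap J\}$. Then the differential $d_s\colon E_s^{p,-1}\to E_s^{p-s+1,s-1}$ defines a map $$\widetilde H^p(K_J)\longrightarrow\bigoplus_{\substack{i_0<\cdots<i_{s-1}\\ i_0,\dots,i_{s-1}\in I\cap J}}\widetilde H^{p-s+1}(K_{J\smallsetminus i_0\cdots i_{s-1}})$$ with each component given by $(-1)^{\varepsilon(i_0\ldots i_{s-1},J)+p+s}\,\delta_{i_0\cdots i_{s-1}}$.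
   Context: A simplicial complex $K$ on vertex set $[m]=\{1,\dots,m\}$ contains $\varnothing$ and all $\{i\}$. $K_U=\{\sigma\in K:\sigma\subseteq U\}$; $\widetilde C^*,\widetilde H^*$ are reduced simplicial cochains and cohomology with coefficients in $k$; $J\smallsetminus i_0\cdots i_q$ means $J\smallsetminus\{i_0,\dots,i_q\}$. For $A,B\subseteq[m]$, $\varepsilon(A,B)=|\{(a,b)\in A\times B:a>b\}|$, and $\varepsilon(i_0\ldots i_n,B)=\varepsilon(\{i_0,\dots,i_n\},B)$, $\varepsilon(i,B)=\varepsilon(\{i\},B)$. Čech double complex: for $q\geqslant0$, $\check C^q(\mathcal{U}_{I,J},\widetilde C^p)=\bigoplus_{i_0<\cdots<i_q\in I\cap J}\widetilde C^p(K_{J\smallsetminus i_0\cdots i_q})$, with Čech differential $(\check d\omega)_{i_0\cdots i_q}=\sum_{\ell=0}^q(-1)^\ell\omega_{i_0\cdots\widehat{i_\ell}\cdots i_q}|_{K_{J\smallsetminus i_0\cdots i_q}}$. The augmented double complex adds the row $q=-1$ given by $\widetilde C^p(K_J)$. The horizontal differential $d$ is the simplicial cochain differential ($p\mapsto p+1$); the vertical map is $\partial_v=(-1)^p\check d$ from row $q\geqslant0$ to row $q+1$, and from row $-1$ to row $0$ it is restriction $\alpha\mapsto(\alpha|_{K_{J\smallsetminus i}})_i$. The augmented Mayer--Vietoris spectral sequence is obtained by first taking horizontal cohomology, so $E_1^{p,-1}=\widetilde H^p(K_J)$ and $E_1^{p,q}=\bigoplus_{i_0<\cdots<i_q\in I\cap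 J}\widetilde H^p(K_{J\smallsetminus i_0\cdots i_q})$ for $q\ge0$. Its differentials $d_s\colon E_s^{p,q}\to E_s^{p-s+1,q+s}$ are computed by zig-zags with the sign convention: if $x_0$ represents a class, and $x_1,\dots,x_{s-1}$ satisfy $d x_{\ell}=\partial_v x_{\ell-1}$ for $1\leqslant\ell\leqslant s-1$, then $d_s[x_0]=[\partial_v x_{s-1}]$. Higher operations: $N=\bigoplus_{U\subseteq[m]}\widetilde C^*(K_U)$ is a dg module over $\Lambda(\iota_1,\dots,\iota_m)$, where for $\omega\in\widetilde C^p(K_U)$, $\iota_j\omega=(-1)^{\varepsilon(j,U)+p+1}\omega|_{K_{U\smallsetminus j}}$ if $j\in U$ and $\iota_j\omega=0$ otherwise (this is isomorphic to the cellular cochains of the moment-angle complex $\mathcal{Z}_K$ with the $\Lambda$-action induced by the torus action). For $V=\{i_0,\dots,i_{s-1}\}$ and a class $[\alpha]$, choose $\alpha_W\in N$ for $W\subsetneq V$ with $\alpha_\varnothing=\alpha$ and $d\alpha_W=\sum_{i\in W}\iota_i\alpha_{W\smallsetminus i}$ for $\varnothing\neq W\subsetneq V$ (compatibly with the decomposition: $\alpha_W\in\widetilde C^{*}(K_{J\smallsetminus W})$ when $\alpha\in\widetilde C^*(K_J)$); then $\delta_V[\alpha]=\delta_{i_0\cdots i_{s-1}}[\alpha]=\big[\sum_{i\in V}\iota_i\alpha_{V\smallsetminus i}\big]$. In particular $\delta_i=\iota_i$. This is well defined on $\widetilde H^p(K_J)$ when the relevant lower operations vanish. *)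

(* Defs.v *)
From HB Require Import structures.
From mathcomp Require Import boolp classical_sets.
From mathcomp Require Import all_boot all_order all_algebra.

Set Implicit Arguments.
Unset Strict Implicit.
Unset Printing Implicit Defensive.

Import Order.TTheory GRing.Theory Num.Theory.
Local Open Scope ring_scope.
Local Open Scope quotient_scope.

(** * Subquotients of a vector space *)

Section Subquotient.
Variables (k : fieldType) (vT : vectType k) (Z B : {vspace vT}).

Definition subquot_ker : {vspace subvs_of Z} :=
  (linfun (vsval : subvs_of Z -> vT) @^-1: B)%VS.

(* The quotient Z / (Z :&: B), that is Z / B when B is contained in Z. *)
Definition subquot := Quotient.quot (pred_of_vspace subquot_ker).

HB.instance Definition _ := GRing.Zmodule.on subquot.

Lemma mem_subquot_ker u : (u \in subquot_ker) = (vsval u \in B).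
Proof. by rewrite -memv_preim lfunE. Qed.

Definition subquot_scale (a : k) (x : subquot) : subquot :=
  \pi_subquot (a *: repr x).

Lemma subquot_eq (u v : subvs_of Z) :
  (\pi_subquot u = \pi_subquot v) <-> (vsval u - vsval v \in B).
Proof.
rewrite -raddfB -mem_subquot_ker /subquot; split=> [h|h].
  by rewrite Quotient.idealrBE; apply/eqP.
by apply/eqP; rewrite -Quotient.idealrBE.
Qed.

Lemma subquotW (P : subquot -> Prop) :
  (forall u, P (\pi_subquot u)) -> forall x, P x.
Proof. by move=> Pu x; rewrite -[x]reprK. Qed.

Lemma pi_subquot_scale a u :
  subquot_scale a (\pi_subquot u) = \pi_subquot (a *: u).
Proof.
apply/subquot_eq; rewrite -[X in X \in _]/(a *: vsval _ - a *: vsval u).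
by rewrite -scalerBr memvZ //; apply/subquot_eq; rewrite reprK.
Qed.

Fact subquot_scaleA a b (v : subquot) :
  subquot_scale a (subquot_scale b v) = subquot_scale (a * b) v.
Proof. by elim/subquotW: v => u; rewrite !pi_subquot_scale scalerA. Qed.

Fact subquot_scale1 : left_id 1 subquot_scale.
Proof. by elim/subquotW=> v; rewrite pi_subquot_scale scale1r. Qed.

Fact subquot_scaleDr : right_distributive subquot_scale +%R.
Proof.
move=> a; elim/subquotW=> u; elim/subquotW=> v.
by rewrite -raddfD !pi_subquot_scale scalerDr raddfD.
Qed.

Fact subquot_scaleDl v : {morph subquot_scale^~ v : a b / a + b}.
Proof.
by move=> a b; elim/subquotW: v => v; rewrite !pi_subquot_scale scalerDl raddfD.
Qed.

HB.instance Definition _ := GRing.Zmodule_isLmodule.Build k subquot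
  subquot_scaleA subquot_scale1 subquot_scaleDr subquot_scaleDl.

(* The class of x when x lies in Z; a junk value otherwise. *)
Definition cls (x : vT) : subquot := \pi_subquot (vsproj Z x).

Fact cls_is_linear : linear cls.
Proof.
by move=> a u v; rewrite /cls linearP raddfD; congr (_ + _); exact: esym (pi_subquot_scale _ _).
Qed.

HB.instance Definition _ := GRing.isSemilinear.Build k vT subquot _ cls
  (GRing.semilinear_linear cls_is_linear).

Lemma cls_eq0 x : x \in Z -> (cls x = 0) <-> (x \in B).
Proof.
move=> xZ; have := subquot_eq (vsproj Z x) 0.
have -> : \pi_subquot 0 = 0 :> subquot by exact: raddf0.
by rewrite vsprojK // [X in _ - X]/(0 : vT) subr0.
Qed.

Lemma cls_surj (xi : subquot) : exists2 x, x \in Z & cls x = xi.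
Proof.
elim/subquotW: xi => u; exists (vsval u); first exact: subvsP.
by rewrite /cls vsvalK.
Qed.

End Subquotient.

Arguments cls {k vT} Z B x.

(** * Spectral sequence of a double complex, horizontal cohomology first *)

Section SpectralSequence.
Variables (k : fieldType) (vT : vectType k).
Variables (D : int -> int -> {vspace vT}).    (* the term in bidegree (p, q) *)
Variables (dh : 'End(vT)).                    (* (p, q) -> (p + 1, q) *)
Variables (dv : int -> int -> 'End(vT)).      (* (p, q) -> (p, q + 1) *)

(* x_0, ..., x_{r-1} with x_0 in bidegree (p, q), d x_0 = 0 and
   d x_(l+1) = dv x_l. *)
Definition zigzag (r : nat) (p q : int) (x : nat -> vT) : Prop :=
  [/\ forall l, (l < r)%N -> x l \in D (p - l%:Z) (q + l%:Z),
      dh (x 0%N) = 0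
    & forall l, (l.+1 < r)%N ->
        dh (x l.+1) = dv (p - l%:Z) (q + l%:Z) (x l)].

(* The x_0 of bidegree (p, q) from which n further steps can be taken. *)
Fixpoint zig_start (n : nat) (p q : int) : {vspace vT} :=
  if n is n'.+1 then
    (D p q :&: dv p q @^-1: (dh @: zig_start n' (p - 1) (q + 1)))%VS
  else D p q.

(* The x_n of bidegree (p, q) ending some x_0, ..., x_n with d x_0 = 0. *)
Fixpoint zig_end (n : nat) (p q : int) : {vspace vT} :=
  if n is n'.+1 then
    (D p q :&:
       dh @^-1: (dv (p + 1) (q - 1) @: zig_end n' (p + 1) (q - 1)))%VS
  else (D p q :&: lker dh)%VS.

Definition page_cycles (r : nat) (p q : int) : {vspace vT} :=
  (lker dh :&: zig_start r.-1 p q)%VS.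

Definition page_boundaries (r : nat) (p q : int) : {vspace vT} :=
  (dh @: D (p - 1) q +
   if r is r'.+2 then dv p (q - 1) @: zig_end r' p (q - 1) else 0)%VS.

(* E_r^{p,q}, for r >= 1. *)
Definition page (r : nat) (p q : int) :=
  subquot (page_cycles r p q) (page_boundaries r p q).

Definition page_cls (r : nat) (p q : int) : vT -> page r p q :=
  cls (page_cycles r p q) (page_boundaries r p q).

Definition page_diff_graph (r : nat) (p q : int) (xi : page r p q)
    (eta : page r (p - r%:Z + 1) (q + r%:Z)) : Prop :=
  exists x, [/\ zigzag r p q x, page_cls r p q (x 0%N) = xi
    & eta = page_cls r (p - r%:Z + 1) (q + r%:Z)
        (dv (p - r.-1%:Z) (q + r.-1%:Z) (x r.-1))].

(* d_r : E_r^{p,q} -> E_r^{p-r+1,q+r}; lemma page_diffP below shows that the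
   graph is functional and total, so the default value 0 is never used. *)
Definition page_diff (r : nat) (p q : int) (xi : page r p q) :
    page r (p - r%:Z + 1) (q + r%:Z) :=
  xget 0 [set eta | page_diff_graph xi eta].

Lemma mem_zig_start n p q x : reflect
  (exists2 y, y 0%N = x &
     (forall l, (l <= n)%N -> y l \in D (p - l%:Z) (q + l%:Z)) /\
     (forall l, (l < n)%N -> dh (y l.+1) = dv (p - l%:Z) (q + l%:Z) (y l)))
  (x \in zig_start n p q).
Proof.
elim: n p q x => [|n IHn] p q x /=.
  apply: (iffP idP) => [xD|[y <- [/(_ 0%N isT)]]]; last by rewrite subr0 addr0.
  by exists (fun=> x) => //; split=> // -[|l] // _; rewrite subr0 addr0.
have shp l : p - 1 - l%:Z = p - l.+1%:Z by rewrite -addrA -opprD.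
have shq l : q + 1 + l%:Z = q + l.+1%:Z by rewrite -addrA.
rewrite memv_cap; apply: (iffP andP) => [[xD]|[y <- [yD dy]]].
  rewrite -memv_preim => /memv_imgP[z /IHn[y <- [yD dy]] ez].
  exists (fun l => if l is l'.+1 then y l' else x) => //; split=> [[|l]|[|l]] ln.
  - by rewrite subr0 addr0.
  - by rewrite -shp -shq yD.
  - by rewrite -ez subr0 addr0.
  - by rewrite -shp -shq dy.
split; first by have := yD 0%N isT; rewrite subr0 addr0.
rewrite -memv_preim; apply/memv_imgP; exists (y 1%N); last first.
  by have := dy 0%N isT; rewrite subr0 addr0.
apply/IHn; exists (fun l => y l.+1) => //.
by split=> l ln; rewrite shp shq; [exact: yD | exact: dy].
Qed.

Lemma page_cyclesP r p q x : (0 < r)%N -> reflect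
  (exists2 y, y 0%N = x & zigzag r p q y) (x \in page_cycles r p q).
Proof.
case: r => // r _; rewrite memv_cap memv_ker.
apply: (iffP andP) => [[/eqP dx /mem_zig_start[y ex [yD dy]]]|[y ex [yD d0 dy]]].
  by exists y => //; split; rewrite ?ex.
split; first by rewrite -ex d0.
by apply/mem_zig_start; exists y.
Qed.

Lemma zigzag_end r p q x : zigzag r.+1 p q x ->
  x r \in zig_end r (p - r%:Z) (q + r%:Z).
Proof.
case=> xD d0 dx.
suff h l : (l <= r)%N -> x l \in zig_end l (p - l%:Z) (q + l%:Z) by exact: h.
elim: l => [|l IHl] lr /=; rewrite memv_cap xD //=.
  by rewrite memv_ker d0.
have -> : p - l.+1%:Z + 1 = p - l%:Z by rewrite -addn1 PoszD opprD addrA subrK.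
have -> : q + l.+1%:Z - 1 = q + l%:Z by rewrite -addn1 PoszD addrA addrK.
by rewrite -memv_preim dx // memv_img // IHl // ltnW.
Qed.

Lemma zig_endP n p q x : x \in zig_end n p q ->
  exists2 y, y n = x & zigzag n.+1 (p + n%:Z) (q - n%:Z) y.
Proof.
elim: n p q x => [|n IHn] p q x /=; rewrite memv_cap => /andP[xD].
  rewrite memv_ker => /eqP dx; exists (fun=> x) => //; split=> // -[|l] // _.
  by rewrite ?(subr0, addr0).
have ep : p + 1 + n%:Z = p + n.+1%:Z by rewrite -addrA.
have eq : q - 1 - n%:Z = q - n.+1%:Z by rewrite -addrA -opprD.
rewrite -memv_preim => /memv_imgP[z /IHn[y ez [yD d0 dy]] ex].
exists (fun l => if (l <= n)%N then y l else x); first by rewrite ltnn.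
split=> [l|//|l]; rewrite ?ltnS.
  rewrite leq_eqVlt => /predU1P[->|ln]; first by rewrite ltnn addrK subrK.
  by move: (ln); rewrite ltnS => ->; rewrite -ep -eq yD.
move=> ln; rewrite ln; move: ln; rewrite leq_eqVlt => /predU1P[->|ln].
  by rewrite ltnn ex -ez -ep -eq addrK subrK.
by rewrite ln -ep -eq dy.
Qed.

Section WellDefined.
Hypothesis dvD : forall p q x, x \in D p q -> dv p q x \in D p (q + 1).
Hypothesis dvv : forall p q x, x \in D p q -> dv p (q + 1) (dv p q x) = 0.
Hypothesis dhv : forall p q, exists e : k, forall x, x \in D p q ->
  dh (dv p q x) = e *: dv (p + 1) q (dh x).
Hypothesis dvh : forall p q, exists e : k, forall x, x \in D p q ->
  dv (p + 1) q (dh x) = e *: dh (dv p q x).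

Lemma zigzag_last_cycle r p q x : (0 < r)%N -> zigzag r p q x ->
  dv (p - r.-1%:Z) (q + r.-1%:Z) (x r.-1)
    \in page_cycles r (p - r%:Z + 1) (q + r%:Z).
Proof.
case: r => // r _ [xD d0 dx] /=.
have ep : p - r.+1%:Z + 1 = p - r%:Z by rewrite -addn1 PoszD opprD addrA subrK.
have eq : q + r.+1%:Z = q + r%:Z + 1 by rewrite -addn1 PoszD addrA.
have xr := xD r (ltnSn r).
rewrite ep eq; set z := dv _ _ _.
have zD : z \in D (p - r%:Z) (q + r%:Z + 1) by exact: dvD.
apply/page_cyclesP => //; exists (fun l => if l is 0%N then z else 0) => //.
split=> [[|l] _||[|l] _]; rewrite ?linear0 ?mem0v ?subr0 ?addr0 //.
- have [e he] := dhv (p - r%:Z) (q + r%:Z); rewrite /z he //.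
  case: r {ep eq z zD he} xD dx xr => [|r] xD dx xr; first by rewrite d0 linear0 scaler0.
  rewrite dx //.
  have -> : p - r.+1%:Z + 1 = p - r%:Z by rewrite -addn1 PoszD opprD addrA subrK.
  have -> : q + r.+1%:Z = q + r%:Z + 1 by rewrite -addn1 PoszD addrA.
  by rewrite dvv ?scaler0 // xD.
- by rewrite /z dvv.
Qed.

Lemma zigzag_indeterminacy r p q x : (0 < r)%N -> zigzag r p q x ->
  x 0%N \in page_boundaries r p q ->
  dv (p - r.-1%:Z) (q + r.-1%:Z) (x r.-1)
    \in page_boundaries r (p - r%:Z + 1) (q + r%:Z).
Proof.
case: r => [//|r] _ [xD d0 dx] /memv_addP[_ /memv_imgP[y yD ->]] [w wP x0E].
rewrite /page_boundaries.
have ep : p - r.+1%:Z + 1 = p - r%:Z by rewrite -addn1 PoszD opprD addrA subrK.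
have eq : q + r.+1%:Z = q + r%:Z + 1 by rewrite -addn1 PoszD addrA.
rewrite ep eq /=.
have [e he] := dvh (p - 1) q.
have {}he : dv p q (dh y) = e *: dh (dv (p - 1) q y).
  by have := he _ yD; rewrite subrK.
case: r ep eq wP xD dx => [|r] ep eq wP xD dx.
  move: wP; rewrite memv0 => /eqP w0; rewrite ?(subr0, addr0) addv0.
  rewrite x0E w0 addr0 he memvZ // memv_img //.  exact: dvD.
apply: (subvP (addvSr _ _)); rewrite addrK.
have dvw : dv p q w = 0.
  have /memv_imgP[z zP ->] := wP; rewrite /= in zP.
  have zD : z \in D p (q - 1).
    by move: zP; case: (r) => [|n] /=; rewrite memv_cap => /andP[].
  by have := dvv zD; rewrite subrK.
have dvy : dv (p - 1) q y \in D (p - 1) (q + 1) by exact: dvD.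
have sp l : p - 1 - l%:Z = p - l.+1%:Z by rewrite -addrA -opprD.
have sq l : q + 1 + l%:Z = q + l.+1%:Z by rewrite -addrA.
have x1D : x 1%N \in D (p - 1) (q + 1) by exact: xD.
pose x' l := if l is 0%N then x 1%N - e *: dv (p - 1) q y else x l.+1.
have dvx0 : dv (p - 1) (q + 1) (x' 0%N) = dv (p - 1) (q + 1) (x 1%N).
  by rewrite /x' linearB linearZ /= dvv // scaler0 ?subr0.
have zz : zigzag r.+1 (p - 1) (q + 1) x'.
  split=> [[|l] lr||[|l] lr].
  - by rewrite subr0 addr0 memvB // memvZ.
  - by rewrite sp sq; exact: xD.
  - rewrite /x' linearB linearZ /= dx // subr0 addr0 x0E linearD /= he dvw addr0.
    by rewrite subrr.
  - by rewrite subr0 addr0 dvx0 dx.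
  - by rewrite sp sq /x' dx.
have := zigzag_end zz; rewrite sp sq => /(memv_img (dv (p - r.+1%:Z) (q + r.+1%:Z))).
have -> : dv (p - r.+1%:Z) (q + r.+1%:Z) (x r.+1) =
          dv (p - r.+1%:Z) (q + r.+1%:Z) (x' r) by case: (r).
by [].
Qed.

Lemma page_diffP r p q (xi : page r p q) : (0 < r)%N ->
  [set eta | page_diff_graph xi eta]%classic = [set page_diff xi]%classic.
Proof.
move=> r0.
have uniq eta eta' :
    page_diff_graph xi eta -> page_diff_graph xi eta' -> eta = eta'.
  move=> [x [zx ex ->]] [y [zy ey ->]].
  apply/eqP; rewrite -subr_eq0 /page_cls -linearB -linearB /=; apply/eqP.
  have zB : zigzag r p q (x \- y).
    case: zx zy => [xD x0 dx] [yD y0 dy]; split=> /= [l lr||l lr].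
    - by rewrite memvB ?xD ?yD.
    - by rewrite linearB /= x0 y0 subrr.
    - by rewrite !linearB /= dx // dy.
  apply/cls_eq0; first exact: (zigzag_last_cycle r0 zB).
  apply: (zigzag_indeterminacy r0 zB).
  apply/(@cls_eq0 _ _ (page_cycles r p q)).
    by apply/page_cyclesP => //; exists (x \- y).
  by rewrite linearB /=; apply/eqP; rewrite subr_eq0; apply/eqP; rewrite [LHS]ex -ey.
have ex : exists eta, page_diff_graph xi eta.
  have [x0 /page_cyclesP -/(_ r0)[x ex zx] cx] := cls_surj xi.
  by eexists; exists x; split; [exact: zx | rewrite ex | reflexivity].
have gP : page_diff_graph xi (page_diff xi) by exact: (xgetPex 0 ex).
by apply/seteqP; split=> [eta /uniq/(_ gP)|_ ->].
Qed.

End WellDefined.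
End SpectralSequence.

(** * Simplicial cochains *)

Notation cochain k m := {ffun {set 'I_m} -> k^o}.
Notation cochain_family k m := {ffun {set 'I_m} -> cochain k m}.

Section Simplicial.
Variables (k : fieldType) (m : nat).
Implicit Types (A B U V W sigma tau : {set 'I_m}) (K L : {set {set 'I_m}}).

Definition eps A B : nat :=
  #|[set ab : 'I_m * 'I_m | [&& ab.1 \in A, ab.2 \in B & (ab.2 < ab.1)%N]]|.

(* The vertex set [m] is 'I_m, that is {0, ..., m-1}: only its order matters. *)
Definition simplicial_complex K : Prop :=
  [/\ set0 \in K, forall i, [set i] \in K
    & forall sigma tau, sigma \in K -> tau \subset sigma -> tau \in K].

Definition full_sub K U : {set {set 'I_m}} := [set sigma in K | sigma \subset U].

(* C~^p(L), as a space of functions on all the subsets of [m]; the simplices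
   are oriented by the order of [m], and the empty simplex has dimension -1. *)
Definition cochains (p : int) L : {vspace cochain k m} :=
  (\sum_(sigma in L | (#|sigma|%:Z == p + 1)%R)
     <[ [ffun tau => (tau == sigma)%:R] : cochain k m ]>)%VS.

Lemma cochainsP p L (f : cochain k m) : reflect
  (forall sigma, f sigma != 0 -> sigma \in L /\ #|sigma|%:Z = p + 1)
  (f \in cochains p L).
Proof.
apply: (iffP idP) => [/memv_sumP[g gP ->] s|fP].
  rewrite sum_ffunE => nz.
  have [t /andP[tL /eqP tp] nz'] : exists2 t,
      (t \in L) && (#|t|%:Z == p + 1) & g t s != 0.
    apply/exists_inP; apply: contraNT nz => /exists_inPn h.
    by rewrite big1 // => t tP; apply/eqP; rewrite -[_ == _]negbK h.
  have /vlineP[a ga] : g t \in <[ [ffun u => (u == t)%:R] : cochain k m ]>%VS.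
    by apply: gP; rewrite tL tp eqxx.
  move: nz'; rewrite ga !ffunE; have [->|_] := eqVneq s t; first by [].
  by rewrite scaler0 eqxx.
have -> : f = \sum_(s in L | #|s|%:Z == p + 1)
                f s *: ([ffun t => (t == s)%:R] : cochain k m).
  apply/ffunP=> t; rewrite sum_ffunE; under eq_bigr do rewrite !ffunE.
  have [tP|tP] := boolP ((t \in L) && (#|t|%:Z == p + 1)).
    rewrite (bigD1 t) //= eqxx big1 ?addr0; last first.
      by move=> s /andP[_ /negPf]; rewrite eq_sym => ->; rewrite scaler0.
    by rewrite -[RHS]/(_ * _) mulr1.
  rewrite big1; last first.
    move=> s sP; case: eqVneq => [ts|_]; last by rewrite scaler0.
    by rewrite ts sP in tP.
  by apply/eqP; apply: contraNT tP => /fP[-> /eqP].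
by apply: memv_sumr => s sP; rewrite memvZ // memv_line.
Qed.

Definition restr L (f : cochain k m) : cochain k m :=
  [ffun sigma => if sigma \in L then f sigma else 0].

(* If sigma = {v_0 < ... < v_n}, then eps {v_l} sigma = l. *)
Definition cobound L (f : cochain k m) : cochain k m :=
  [ffun sigma => if sigma \in L then
     \sum_(i in sigma) (-1) ^+ eps [set i] sigma * f (sigma :\ i) else 0].

Fact restr_is_linear L : linear (restr L).
Proof.
move=> a f g; apply/ffunP=> s; rewrite !ffunE; case: ifP => // _.
by rewrite scaler0 addr0.
Qed.
HB.instance Definition _ L := GRing.isSemilinear.Build k (cochain k m)
  (cochain k m) _ (restr L) (GRing.semilinear_linear (restr_is_linear L)).

Fact cobound_is_linear L : linear (cobound L).
Proof.
move=> a f g; apply/ffunP=> s; rewrite !ffunE; case: ifP => // _; last first.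
  by rewrite scaler0 addr0.
rewrite scaler_sumr -big_split; apply: eq_bigr => i _ /=.
by rewrite !ffunE mulrDr scalerAr.
Qed.
HB.instance Definition _ L := GRing.isSemilinear.Build k (cochain k m)
  (cochain k m) _ (cobound L) (GRing.semilinear_linear (cobound_is_linear L)).

Definition cocycles (p : int) L : {vspace cochain k m} :=
  (cochains p L :&: lker (linfun (cobound L)))%VS.

Definition coboundaries (p : int) L : {vspace cochain k m} :=
  (linfun (cobound L) @: cochains (p - 1) L)%VS.

(* H~^p(L) *)
Definition rcohom (p : int) L := subquot (cocycles p L) (coboundaries p L).

Definition rcohom_cls (p : int) L : cochain k m -> rcohom p L :=
  cls (cocycles p L) (coboundaries p L).

HB.instance Definition _ p L := GRing.Linear.on (@rcohom_cls p L).

(** * Higher operations *)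

(* iota_j on the summand C~^p(K_U) of N, with values in C~^p(K_{U \ j}). *)
Definition iota_act K (p : int) U (j : 'I_m) (f : cochain k m) : cochain k m :=
  if j \in U then
    (-1) ^ ((eps [set j] U)%:Z + p + 1) *: restr (full_sub K (U :\ j)) f
  else 0.

(* sum_{i in W} iota_i a_{W \ i}, where a_{W \ i} has degree p - |W \ i| and
   lives on K_{J \ (W \ i)}. *)
Definition iota_sum K J (p : int) W (a : {set 'I_m} -> cochain k m) :
    cochain k m :=
  \sum_(i in W) iota_act K (p - #|W :\ i|%:Z) (J :\: (W :\ i)) i (a (W :\ i)).

Definition defining_system K J (p : int) V (alpha : cochain k m)
    (a : {set 'I_m} -> cochain k m) : Prop :=
  [/\ a set0 = alpha,
      forall W, W \proper V ->
        a W \in cochains (p - #|W|%:Z) (full_sub K (J :\: W))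
    & forall W, W != set0 -> W \proper V ->
        cobound (full_sub K (J :\: W)) (a W) = iota_sum K J p W a].

(* The set of all values of delta_V on xi, for V of cardinality s, over all
   choices of a representative and of a defining system. *)
Definition higher_op K J (p : int) (s : nat) V
    (xi : rcohom p (full_sub K J)) :
    set (rcohom (p - s%:Z + 1) (full_sub K (J :\: V))) :=
  [set eta | exists alpha a,
     [/\ alpha \in cocycles p (full_sub K J), rcohom_cls p (full_sub K J) alpha = xi,
         defining_system K J p V alpha a
       & eta = rcohom_cls (p - s%:Z + 1) (full_sub K (J :\: V))
                 (iota_sum K J p V a)]]%classic.

(** * The augmented Mayer-Vietoris spectral sequence *)

Definition single W (f : cochain k m) : cochain_family k m :=
  [ffun W' => if W' == W then f else 0].

Fact single_is_linear W : linear (single W).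
Proof.
move=> a f g; apply/ffunP=> W'; rewrite !ffunE; case: ifP => // _.
by rewrite scaler0 addr0.
Qed.
HB.instance Definition _ W := GRing.isSemilinear.Build k (cochain k m)
  (cochain_family k m) _ (single W) (GRing.semilinear_linear (single_is_linear W)).

Section MayerVietoris.
Variables (K : {set {set 'I_m}}) (I J : {set 'I_m}).

(* The indices i_0 < ... < i_q are encoded by the set W = {i_0, ..., i_q}, of
   cardinality q + 1; the augmentation row q = -1 corresponds to W = set0. *)
Definition mv_index (q : int) (W : {set 'I_m}) : bool :=
  (W \subset I :&: J) && (#|W|%:Z == q + 1).

Definition mv_term (p q : int) : {vspace cochain_family k m} :=
  (\sum_(W | mv_index q W)
     linfun (single W) @: cochains p (full_sub K (J :\: W)))%VS.

Definition mv_horiz (w : cochain_family k m) : cochain_family k m :=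
  [ffun W : {set 'I_m} => cobound (full_sub K (J :\: W)) (w W)].

(* If W = {i_0 < ... < i_q}, then eps {i_l} W = l.  From row -1 to row 0 this
   is the family of restrictions. *)
Definition cech (w : cochain_family k m) : cochain_family k m :=
  [ffun W : {set 'I_m} => if W \subset I :&: J then
     \sum_(i in W)
       (-1) ^+ eps [set i] W *: restr (full_sub K (J :\: W)) (w (W :\ i))
   else 0].

Definition mv_vert (p q : int) (w : cochain_family k m) : cochain_family k m :=
  if q == -1 then cech w else (-1) ^ p *: cech w.

Fact mv_horiz_is_linear : linear mv_horiz.
Proof. by move=> a f g; apply/ffunP=> W; rewrite !ffunE linearP. Qed.
HB.instance Definition _ := GRing.isSemilinear.Build k (cochain_family k m)
  (cochain_family k m) _ mv_horiz (GRing.semilinear_linear mv_horiz_is_linear).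

Fact cech_is_linear : linear cech.
Proof.
move=> a f g; apply/ffunP=> W; rewrite !ffunE; case: ifP => // _; last first.
  by rewrite scaler0 addr0.
rewrite scaler_sumr -big_split; apply: eq_bigr => i _ /=.
by rewrite !ffunE linearP scalerDr !scalerA mulrC.
Qed.
HB.instance Definition _ := GRing.isSemilinear.Build k (cochain_family k m)
  (cochain_family k m) _ cech (GRing.semilinear_linear cech_is_linear).

Fact mv_vert_is_linear p q : linear (mv_vert p q).
Proof.
move=> a f g; rewrite /mv_vert; case: ifP => _; first exact: linearP.
by rewrite linearP scalerDr !scalerA mulrC.
Qed.
HB.instance Definition _ p q := GRing.isSemilinear.Build k (cochain_family k m)
  (cochain_family k m) _ (mv_vert p q) (GRing.semilinear_linear (mv_vert_is_linear p q)).

(* E_r^{p,q}, the class in it of an element of bidegree (p, q), and d_r. *)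
Definition mv_page (r : nat) (p q : int) :=
  page mv_term (linfun mv_horiz) (fun p q => linfun (mv_vert p q)) r p q.

Definition mv_cls (r : nat) (p q : int) : cochain_family k m -> mv_page r p q :=
  page_cls mv_term (linfun mv_horiz) (fun p q => linfun (mv_vert p q))
    r p q.

HB.instance Definition _ r p q := GRing.Linear.on (@mv_cls r p q).

Definition mv_cycles (r : nat) (p q : int) : {vspace cochain_family k m} :=
  page_cycles mv_term (linfun mv_horiz) (fun p q => linfun (mv_vert p q)) r p q.

Definition mv_diff (r : nat) (p q : int) (xi : mv_page r p q) :
    mv_page r (p - r%:Z + 1) (q + r%:Z) :=
  page_diff xi.

Lemma mv_termP p q (w : cochain_family k m) : reflect
  (forall W, if mv_index q W then is_true (w W \in cochains p (full_sub K (J :\: W)))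
             else w W = 0)
  (w \in mv_term p q).
Proof.
apply: (iffP idP) => [/memv_sumP[g gP ->] W|wP].
  rewrite sum_ffunE; have [Wq|Wq] := boolP (mv_index q W).
    apply: memv_suml => V Vq; have /memv_imgP[f fC ->] := gP V Vq.
    rewrite lfunE ffunE; case: eqVneq fC => [->//|_ _]; exact: mem0v.
  apply: big1 => V Vq; have /memv_imgP[f fC ->] := gP V Vq.
  by rewrite lfunE ffunE; case: eqVneq Vq => // <-; rewrite (negPf Wq).
have -> : w = \sum_(W | mv_index q W) linfun (single W) (w W).
  apply/ffunP=> W; rewrite sum_ffunE.
  under eq_bigr do rewrite lfunE ffunE.
  have := wP W; case: ifP => [Wq _|Wq w0].
    rewrite (bigD1 W) //= eqxx big1 ?addr0 // => V /andP[_ /negPf].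
    by rewrite eq_sym => ->.
  by rewrite big1 // => V Vq; case: eqVneq Vq => // <-; rewrite Wq.
by apply: memv_sumr => W Wq; have := wP W; rewrite Wq => h; exact: memv_img.
Qed.

Lemma mv_vert_term p q w :
  w \in mv_term p q -> mv_vert p q w \in mv_term p (q + 1).
Proof.
move=> /mv_termP wP.
suff h : cech w \in mv_term p (q + 1) by rewrite /mv_vert; case: ifP => _; rewrite ?memvZ.
apply/mv_termP => W; rewrite /mv_index ffunE; case: (boolP (W \subset _)) => //= WI.
have q1 i : i \in W -> (#|W :\ i|%:Z == q + 1) = (#|W|%:Z == q + 1 + 1).
  by move=> iW; rewrite [in RHS](cardsD1 i) iW add1n -addn1 PoszD (inj_eq (addIr _)).
have WiI i : W :\ i \subset I :&: J by exact: subset_trans (subD1set _ _) WI.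
case: ifP => Wq; last first.
  apply: big1 => i iW; have := wP (W :\ i); rewrite /mv_index WiI q1 // Wq /= => ->.
  by rewrite linear0 scaler0.
apply: memv_suml => i iW; rewrite memvZ //; apply/cochainsP => s; rewrite ffunE.
case: ifP => [sL|_]; last by rewrite eqxx.
by have := wP (W :\ i); rewrite /mv_index WiI q1 // Wq /= => /cochainsP wC /wC[_].
Qed.

Lemma eps1_sub i j W : i \in W -> j \in W -> (i < j)%N ->
  eps [set i] (W :\ j) = eps [set i] W /\
  eps [set j] W = (eps [set j] (W :\ i)).+1.
Proof.
have e1 (a : 'I_m) B : eps [set a] B = #|[set b in B | (b < a)%N]|.
  have inja : injective (pair a : 'I_m -> 'I_m * 'I_m) by move=> x y [].
  rewrite /eps -(card_imset [set b in B | (b < a)%N] inja); congr #|pred_of_set _|.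
  apply/setP => -[x y]; rewrite inE /=; apply/and3P/imsetP.
    by case=> /set1P -> yB ya; exists y => //; rewrite inE yB.
  by case=> z; rewrite inE => /andP[zB za] [-> ->]; split=> //; rewrite inE.
move=> iW jW ij; rewrite !e1; split.
  apply: eq_card => b; rewrite !inE; case: eqVneq => // -> /=.
  by rewrite jW /= ltnNge ltnW.
rewrite (cardsD1 i) inE iW ij add1n; congr _.+1; apply: eq_card => b.
by rewrite !inE andbA.
Qed.

Lemma full_subS V U : V \subset U -> full_sub K V \subset full_sub K U.
Proof.
move=> VU; apply/subsetP => s; rewrite !inE => /andP[-> /=].
by move/subset_trans; apply.
Qed.

Lemma restr_restr L L' (f : cochain k m) :
  L \subset L' -> restr L (restr L' f) = restr L f.
Proof.
move=> /subsetP LL'; apply/ffunP=> s; rewrite !ffunE.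
by case: ifP => // /LL' ->.
Qed.

Lemma cechK w : cech (cech w) = 0.
Proof.
apply/ffunP=> W; rewrite !ffunE; case: ifP => // WI.
pose T i j : cochain k m :=
  (-1) ^+ (eps [set i] W + eps [set j] (W :\ i)) *:
  restr (full_sub K (J :\: W)) (w (W :\ i :\ j)).
have -> : \sum_(i in W) (-1) ^+ eps [set i] W *:
    restr (full_sub K (J :\: W)) (cech w (W :\ i)) =
    \sum_(i in W) \sum_(j in W | j != i) T i j.
  apply: eq_bigr => i iW; rewrite ffunE.
  rewrite (subset_trans (subD1set _ _) WI) linear_sum scaler_sumr /=.
  rewrite [RHS](eq_bigl (fun j => j \in W :\ i)); last first.
    by move=> j; rewrite !inE andbC.
  apply: eq_bigr => j jW; rewrite linearZ /= restr_restr ?scalerA -?exprD //.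
  by apply/full_subS/setDS/subD1set.
have -> : \sum_(i in W) \sum_(j in W | j != i) T i j =
    \sum_(i in W) \sum_(j in W | (i < j)%N) T i j +
    \sum_(i in W) \sum_(j in W | (j < i)%N) T i j.
  rewrite -big_split; apply: eq_bigr => i iW.
  rewrite (bigID (fun j : 'I_m => (i < j)%N)) /=; congr (_ + _).
    apply: eq_bigl => j; rewrite -andbA; congr (_ && _).
    by rewrite -(inj_eq val_inj) /=; case: ltngtP.
  apply: eq_bigl => j; rewrite -andbA; congr (_ && _).
  by rewrite -(inj_eq val_inj) /=; case: ltngtP.
rewrite [X in _ + X](exchange_big_dep (mem W)) /=; last by move=> i j _ /andP[].
rewrite -big_split big1 // => i iW /=.
rewrite [X in _ + X](eq_bigl (fun j : 'I_m => (j \in W) && (i < j)%N)); last first.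
  by move=> j; rewrite iW.
rewrite -big_split big1 // => j /andP[jW ij] /=; rewrite /T.
have [e1 e2] := eps1_sub iW jW ij.
have -> : W :\ j :\ i = W :\ i :\ j by rewrite !setDDl setUC.
rewrite e1 e2 -scalerDl addSn exprS mulN1r addrC [(eps _ (_ :\ i) + _)%N]addnC.
by rewrite addNr scale0r.
Qed.

Hypothesis simpK : simplicial_complex K.

Lemma mv_horiz_cech w : mv_horiz (cech w) = cech (mv_horiz w).
Proof.
apply/ffunP=> W; rewrite !ffunE; case: ifP => WI; last exact: linear0.
rewrite linear_sum; apply: eq_bigr => i iW; rewrite linearZ /= ffunE.
congr (_ *: _); apply/ffunP=> s; rewrite !ffunE; case: ifP => // sL.
have [_ _ Kdown] := simpK.
have -> : s \in full_sub K (J :\: (W :\ i)).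
  by apply: (subsetP (full_subS _)) sL; apply/setDS/subD1set.
apply: eq_bigr => j js; rewrite ffunE ifT //; move: sL; rewrite !inE.
case/andP=> sK sJ; rewrite (Kdown s) ?subD1set //=.
exact: subset_trans (subD1set _ _) sJ.
Qed.

(* The graph of d_r is that of a function, namely mv_diff. *)
Lemma mv_diffP r p q (xi : mv_page r p q) : (0 < r)%N ->
  [set eta | page_diff_graph xi eta]%classic = [set mv_diff xi]%classic.
Proof.
have sgn0 (e : int) : (-1 : k) ^ e != 0.
  by rewrite expfz_neq0 // oppr_eq0 oner_eq0.
apply: page_diffP => {xi r p q} [p q w|p q w _|p q|p q].
- by rewrite lfunE; exact: mv_vert_term.
- rewrite !lfunE /= /mv_vert.
  by case: ifP => _; case: ifP => _; rewrite ?linearZ /= cechK ?scaler0.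
- exists (if q == -1 then 1 else (-1) ^ p / (-1) ^ (p + 1)) => w _.
  rewrite !lfunE /= /mv_vert; case: ifP => _.
    by rewrite scale1r mv_horiz_cech.
  by rewrite linearZ /= mv_horiz_cech scalerA divfK.
- exists (if q == -1 then 1 else (-1) ^ (p + 1) / (-1) ^ p) => w _.
  rewrite !lfunE /= /mv_vert; case: ifP => _.
    by rewrite scale1r mv_horiz_cech.
  by rewrite linearZ /= mv_horiz_cech scalerA divfK.
Qed.

End MayerVietoris.
End Simplicial.

Arguments higher_op {k m K J p} s V xi _.

(* Main.v *)
Require Import Defs.
From HB Require Import structures.
From mathcomp Require Import boolp classical_sets.
From mathcomp Require Import all_boot all_order all_algebra.
From mathcomp Require Import zify.

(* If d_r = 0 for r < s then E_s = E_1, and every d-cocycle starts a zigzag of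
   length s.  Rescaling the component at W of a zigzag x_0, ..., x_{s-1} that
   starts in row -1 by the sign zig_sign turns the zigzag equations, for W
   contained in V, into the equations of a defining system for delta_V, and the
   last vertical differential into the sum that represents delta_V.  Conversely a
   defining system for V is a zigzag of the double complex of U_{V,J}.  The latter
   degenerates up to page s as well, because a family indexed by subsets of V
   extends by zero to U_{I,J}; the indeterminacy of its d_s therefore consists of
   coboundaries, which makes delta_V single-valued. *)

Set Implicit Arguments.
Unset Strict Implicit.
Unset Printing Implicit Defensive.

Import Order.TTheory GRing.Theory Num.Theory.
Local Open Scope ring_scope.

(** * Linear maps between subquotients *)

Lemma inj_surj_bijective (A B : Type) (f : A -> B) :
  injective f -> (forall y, exists x, f x = y) -> bijective f.
Proof.
by move=> finj /choice[g gK]; exists g => // x; apply: finj; rewrite gK.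
Qed.

Section SubquotientMap.
Variables (k : fieldType) (vT vT' : vectType k).
Variables (Z B : {vspace vT}) (Z' B' : {vspace vT'}).
Variable f : {linear vT -> vT'}.
Hypothesis fZ : forall x, x \in Z -> f x \in Z'.
Hypothesis fB : forall x, x \in Z -> x \in B -> f x \in B'.

Lemma cls_eq (x y : vT) :
  x \in Z -> y \in Z -> cls Z B x = cls Z B y <-> x - y \in B.
Proof.
move=> xZ yZ; have [h h'] := cls_eq0 B (memvB xZ yZ); split=> [e|/h'/eqP].
  by apply: h; rewrite linearB; apply/eqP; rewrite subr_eq0; apply/eqP.
by rewrite linearB subr_eq0 => /eqP.
Qed.

Lemma cls_vsval (u : subvs_of Z) : cls Z B (vsval u) = \pi_(subquot Z B)%qT u.
Proof. by rewrite /cls vsvalK. Qed.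

(** The canonical representative is pushed forward; [fZ] and [fB] make the class independent of that
    choice, which is [subquot_mapE]. *)
Definition subquot_map (xi : subquot Z B) : subquot Z' B' :=
  cls Z' B' (f (vsval (repr xi))).

Lemma subquot_mapE x : x \in Z -> subquot_map (cls Z B x) = cls Z' B' (f x).
Proof.
move=> xZ; have rZ : vsval (repr (cls Z B x)) \in Z by exact: subvsP.
apply/eqP; rewrite -subr_eq0 -linearB -linearB; apply/eqP.
apply/cls_eq0; first by rewrite fZ ?memvB.
apply: fB; first exact: memvB.
by apply/cls_eq => //; rewrite cls_vsval reprK.
Qed.

Fact subquot_map_is_linear : linear subquot_map.
Proof.
move=> a xi eta; have [x xZ <-] := cls_surj xi; have [y yZ <-] := cls_surj eta.
by rewrite -linearP !subquot_mapE ?memvD ?memvZ // linearP /= linearP.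
Qed.

(** Linearity depends on [fZ] and [fB], which inference cannot supply, so the structure is packed by
    hand. *)
Definition subquot_lmap : {linear subquot Z B -> subquot Z' B'} :=
  HB.pack subquot_map (GRing.isSemilinear.Build k (subquot Z B) (subquot Z' B') _
    subquot_map (GRing.semilinear_linear subquot_map_is_linear)).

Lemma subquot_lmapE x : x \in Z -> subquot_lmap (cls Z B x) = cls Z' B' (f x).
Proof. exact: subquot_mapE. Qed.

End SubquotientMap.

(** * Cycles and boundaries of a double complex whose first differentials vanish *)

Section Degeneration.
Variables (k : fieldType) (vT : vectType k) (D : int -> int -> {vspace vT}).
Variables (dh : 'End(vT)) (dv : int -> int -> 'End(vT)).
Hypothesis dvD : forall p q x, x \in D p q -> dv p q x \in D p (q + 1).
Hypothesis dvv : forall p q x, x \in D p q -> dv p (q + 1) (dv p q x) = 0.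
Hypothesis dhv : forall p q, exists e : k, forall x, x \in D p q ->
  dh (dv p q x) = e *: dv (p + 1) q (dh x).
Hypothesis dvh : forall p q, exists e : k, forall x, x \in D p q ->
  dv (p + 1) q (dh x) = e *: dh (dv p q x).

Implicit Types p q : int.

Local Notation zigzag := (zigzag D dh dv).
Local Notation page_cycles := (page_cycles D dh dv).
Local Notation page_boundaries := (page_boundaries D dh dv).

Lemma zigzagB r p q x y :
  zigzag r p q x -> zigzag r p q y -> zigzag r p q (x \- y).
Proof.
move=> [xD x0 dx] [yD y0 dy]; split=> /= [l lr||l lr].
- by rewrite memvB ?xD ?yD.
- by rewrite linearB /= x0 y0 subrr.
- by rewrite !linearB /= dx // dy.
Qed.

Lemma zigzagW r r' p q x : (r' <= r)%N -> zigzag r p q x -> zigzag r' p q x.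
Proof.
move=> r'r [xD x0 dx]; split=> // l lr'; [apply: xD | apply: dx];
  exact: leq_trans lr' r'r.
Qed.

(** A zero fits in front because [dh (z 0) = 0] is the equation it imposes. Zigzags that start one
    step later can thus be subtracted. *)
Lemma zigzag_shift r p q z : zigzag r (p - 1) (q + 1) z ->
  zigzag r.+1 p q (fun l => if l is l'.+1 then z l' else 0).
Proof.
move=> [zD z0 dz]; split=> [[|l] lr||[|l] lr]; rewrite ?linear0 ?mem0v //.
- have -> : p - l.+1%:Z = p - 1 - l%:Z by lia.
  have -> : q + l.+1%:Z = q + 1 + l%:Z by lia.
  exact: zD.
- have -> : p - l.+1%:Z = p - 1 - l%:Z by lia.
  have -> : q + l.+1%:Z = q + 1 + l%:Z by lia.
  exact: dz.
Qed.

Lemma zigzag_extend r p q x y : zigzag r.+1 p q x ->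
  y \in D (p - r.+1%:Z) (q + r.+1%:Z) ->
  dh y = dv (p - r%:Z) (q + r%:Z) (x r) ->
  zigzag r.+2 p q (fun l => if (l <= r)%N then x l else y).
Proof.
move=> [xD x0 dx] yD dy; split=> [l lr||l lr] //.
  case: leqP => [/xD//|rl]; have -> : l = r.+1 by lia.
  exact: yD.
have -> : (l <= r)%N by lia.
case: ltnP => [|rl]; first exact: dx.
by have -> : l = r by lia.
Qed.

(** Row [q + 1] is used so that the vertical map starts in row [q]. For [r = 0] the zigzag is empty
    and only the horizontal boundary remains, hence the default 0. *)
Lemma page_boundariesP r p q x : x \in page_boundaries r.+1 p (q + 1) ->
  exists y z, [/\ y \in D (p - 1) (q + 1), zigzag r (p + r%:Z - 1) (q - r%:Z + 1) z
    & x = dh y + dv p q (if r is r'.+1 then z r' else 0)].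
Proof.
move=> /memv_addP[_ /memv_imgP[y yD ->]] [w wP ->]; exists y.
case: r wP => [|r] /=; first rewrite memv0 => /eqP ->.
  by exists (fun=> 0); split=> //; rewrite ?linear0 //; split=> //; rewrite linear0.
move=> /memv_imgP[z /zig_endP[z' <- zz ->]]; exists z'; split=> //; last by rewrite addrK.
move: zz; have -> : p + r%:Z = p + r.+1%:Z - 1 by lia.
by have -> : q + 1 - 1 - r%:Z = q - r.+1%:Z + 1 by lia.
Qed.

(* Since the last vertical differential is d y plus that of the end of a zigzag
   z starting in bidegree (p - 1, q + 1), subtracting z shifted by one step lets x
   be continued by y. *)
Lemma page_cyclesS r p q : (0 < r)%N ->
  (forall xi : page D dh dv r p q, page_diff xi = 0) ->
  (page_cycles r p q <= page_cycles r.+1 p q)%VS.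
Proof.
case: r => // r _ dr0; apply/subvP => _ /(@page_cyclesP _ _ _ _ _ _ _ _ _ (ltn0Sn r))[x <- zx].
pose eta := page_cls D dh dv r.+1 (p - r.+1%:Z + 1) (q + r.+1%:Z)
  (dv (p - r%:Z) (q + r%:Z) (x r)).
(* By [page_diffP] the graph contains a single value, here 0, so the class computed from this
   particular [x] vanishes. *)
have : [set e | page_diff_graph (page_cls D dh dv r.+1 p q (x 0%N)) e]%classic eta.
  by exists x.
rewrite page_diffP // => /= eta0; rewrite dr0 in eta0.
have zc := zigzag_last_cycle dvD dvv dhv (ltn0Sn r) zx.
have /page_boundariesP : dv (p - r%:Z) (q + r%:Z) (x r) \in
    page_boundaries r.+1 (p - r%:Z) (q + r%:Z + 1).
  have := (cls_eq0 (page_boundaries r.+1 (p - r.+1%:Z + 1) (q + r.+1%:Z)) zc).1 eta0.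
  have -> : p - r.+1%:Z + 1 = p - r%:Z by lia.
  by have -> : q + r.+1%:Z = q + r%:Z + 1 by lia.
move=> [y [z [yD]]]; rewrite !addrK subrK => /zigzag_shift/(zigzagB zx) zz e.
apply/page_cyclesP => //.
exists (fun l => if (l <= r)%N then x l - (if l is l'.+1 then z l' else 0) else y).
  by rewrite subr0.
apply: zigzag_extend => //=.
  have -> : p - r.+1%:Z = p - r%:Z - 1 by lia.
  by have -> : q + r.+1%:Z = q + r%:Z + 1 by lia.
by rewrite linearB /= e; apply/eqP; rewrite -addrA subrr addr0.
Qed.

Lemma page_cycles_degenerate s p q :
  (forall r, (1 <= r < s)%N ->
     forall p q (xi : page D dh dv r p q), page_diff xi = 0) ->
  (page_cycles 1 p q <= page_cycles s p q)%VS.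
Proof.
elim: s => [|[|s] IHs] dr0; [exact: subvv | exact: subvv |].
apply: subv_trans (IHs _) _ => [r /andP[r0 rs]|].
  by apply: dr0; rewrite r0 ltnW.
by apply: page_cyclesS => //; apply: dr0; rewrite /= ltnSn.
Qed.

(** Induction on [r]. The start of the zigzag [z] of a boundary also starts, by degeneration, a
    zigzag [u] of length [s]. Since [z - u] starts at 0, its last vertical differential is a
    boundary of the previous page; that of [u] is horizontally the boundary of the next member of
    [u], which exists because [u] is longer than [z]. *)
Lemma page_boundaries_degenerate s :
  (forall p q, page_cycles 1 p q <= page_cycles s p q)%VS ->
  forall r p q, (r < s)%N -> (page_boundaries r.+1 p q <= page_boundaries 1 p q)%VS.
Proof.
move=> degs; elim=> [//|r IHr] p q rs; apply/subvP => x.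
rewrite -(subrK 1 q) => /page_boundariesP[y [z [yD zz ->]]].
set q1 := q - 1 in yD zz *.
rewrite memvD //; first by apply: (subvP (addvSl _ _)); exact: memv_img.
have z0 : z 0%N \in page_cycles 1 (p + r.+1%:Z - 1) (q1 - r.+1%:Z + 1).
  by apply/page_cyclesP => //; exists z => //; exact: zigzagW zz.
have s0 : (0 < s)%N by exact: leq_ltn_trans rs.
move: z0 => /(subvP (degs _ _))/(@page_cyclesP _ _ _ _ _ _ _ _ _ s0)[u u0 zu].
have /= := zigzag_indeterminacy dvD dvv dvh (ltn0Sn r)
  (zigzagB zz (zigzagW (ltnW rs) zu)).
rewrite /= u0 subrr mem0v => /(_ isT).
have -> : p + r.+1%:Z - 1 - r%:Z = p by lia.
have -> : p + r.+1%:Z - 1 - r.+1%:Z + 1 = p by lia.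
have -> : q1 - r.+1%:Z + 1 + r%:Z = q1 by lia.
have -> : q1 - r.+1%:Z + 1 + r.+1%:Z = q1 + 1 by lia.
move=> /(subvP (IHr _ _ (ltnW rs))) zB.
rewrite -(subrK (u r) (z r)) linearD /= memvD //.
have [uD _ /(_ _ rs)] := zu.
have -> : p + r.+1%:Z - 1 - r%:Z = p by lia.
have -> : q1 - r.+1%:Z + 1 + r%:Z = q1 by lia.
move=> <-; apply: (subvP (addvSl _ _)); apply: memv_img.
have := uD _ rs.
have -> : p + r.+1%:Z - 1 - r.+1%:Z = p - 1 by lia.
by have -> : q1 - r.+1%:Z + 1 + r.+1%:Z = q1 + 1 by lia.
Qed.

End Degeneration.

(** * Comparison of the signs of the double complex with those of the exterior action *)

Section Signs.
Variables (k : fieldType) (m : nat).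
Implicit Types (A B U V W J : {set 'I_m}).

(** The explicit [c] turns an equality of signs into linear arithmetic on the exponents. *)
Lemma exprz_mod2 (a b c : int) : a = b + c * 2 -> (-1 : k) ^ a = (-1) ^ b.
Proof.
have m1 : (-1 : k) \is a GRing.unit by rewrite unitrN1.
move=> ->; rewrite mulr_natr mulr2n !exprzDr // -exprzMl //.
by rewrite mulrNN mul1r exp1rz mulr1.
Qed.

Lemma eps_set0 J : eps set0 J = 0%N.
Proof. by apply/eqP; rewrite cards_eq0; apply/eqP/setP => -[a b]; rewrite !inE. Qed.

Lemma eps_addl i A J : i \in A -> eps A J = (eps [set i] J + eps (A :\ i) J)%N.
Proof.
move=> iA; rewrite /eps.
set X := [set ab | _]; rewrite -(cardsID [set ab | ab.1 == i] X).
congr (_ + _)%N; apply: eq_card => -[a b]; rewrite !inE /=.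
  by case: eqVneq => [->|]; rewrite ?iA ?andbF //= andbT.
by rewrite andbA.
Qed.

Lemma eps_addr i B J : B \subset J ->
  eps [set i] J = (eps [set i] (J :\: B) + eps [set i] B)%N.
Proof.
move=> /subsetP BJ; rewrite /eps.
set X := [set ab | _]; rewrite -(cardsID [set ab | ab.2 \in B] X) addnC.
congr (_ + _)%N; apply: eq_card => -[a b]; rewrite !inE /=.
  by case: (boolP (b \in B)) => [/BJ|]; rewrite ?andbF // => ->; rewrite andbC.
by case: (boolP (b \in B)) => [/BJ->|]; rewrite ?andbF ?andbT.
Qed.

Lemma eps_D1 i W : eps [set i] (W :\ i) = eps [set i] W.
Proof.
apply: eq_card => -[a b]; rewrite !inE /=.
by case: eqVneq => //= ->; case: eqVneq => //= ->; rewrite ltnn andbF.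
Qed.

(* The factor between the component at W of a zigzag starting in row -1 and the
   corresponding member of a defining system; row -1 is exceptional because the
   vertical map out of it carries no sign. *)
Definition zig_sign J (p : int) W : k :=
  if W == set0 then 1 else (-1) ^ ((eps W J)%:Z + p + #|W|%:Z).

Lemma zig_sign_sqr J p W : zig_sign J p W * zig_sign J p W = 1.
Proof.
rewrite /zig_sign; case: ifP => _; first exact: mulr1.
rewrite -exprzDr ?unitrN1 //.
by rewrite (@exprz_mod2 _ 0 ((eps W J)%:Z + p + #|W|%:Z)) //; lia.
Qed.

Variables (K : {set {set 'I_m}}).

(** Both sides are sums over [i] in [W] of signed restrictions of [a (W :\ i)]. The signs agree
    because [eps W J] splits into the contributions of [i] and [W :\ i], and that of [i] splits
    again along [W :\ i] and its complement in [J]. *)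
Lemma mv_vert_iota I J p W l (w : cochain_family k m) (a : {set 'I_m} -> cochain k m) :
  W \subset I :&: J -> #|W| = l.+1 ->
  (forall i, i \in W -> w (W :\ i) = zig_sign J p (W :\ i) *: a (W :\ i)) ->
  mv_vert K I J (p - l%:Z) (-1 + l%:Z) w W =
  zig_sign J p W *: iota_sum K J p W a.
Proof.
move=> WIJ Wl wa.
have [_ WJ] : W \subset I /\ W \subset J by apply/andP; rewrite -subsetI.
have W0 : (W == set0) = false by rewrite -cards_eq0 Wl.
have -> : mv_vert K I J (p - l%:Z) (-1 + l%:Z) w W =
    (if l == 0%N then 1 else (-1) ^ (p - l%:Z)) *: cech K I J w W.
  rewrite /mv_vert; have -> : (-1 + l%:Z == -1) = (l == 0%N) by lia.
  by case: ifP => _; rewrite ?scale1r // ffunE.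
rewrite ffunE WIJ /iota_sum !scaler_sumr; apply: eq_bigr => i iW.
have iJ : i \in J by exact: (subsetP WJ).
have Wil : #|W :\ i| = l by have := cardsD1 i W; rewrite iW Wl; lia.
rewrite /iota_act Wil !inE eqxx iJ /= wa //.
have -> : (J :\: (W :\ i)) :\ i = J :\: W by rewrite setDDl setUC setD1K.
rewrite [restr _ (_ *: _)]linearZ /= !scalerA; congr (_ *: _).
rewrite /zig_sign W0 -[_ == set0]cards_eq0 Wl Wil.
rewrite (eps_addl J iW) (@eps_addr i (W :\ i) J); last first.
  exact: subset_trans (subD1set _ _) WJ.
have m1 : (-1 : k) \is a GRing.unit by rewrite unitrN1.
rewrite eps_D1 [X in _ * X * _]exprnP -exprzDr //.
(* Out of row -1 the vertical map has no factor [(-1) ^ p], and [zig_sign] at the empty set is 1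
   instead of [(-1) ^ p]; the two exceptions cancel. *)
case: (l =P 0%N) => [l0|_]; last first.
  (* The count [e] occurs once in [eps W J] and once in the sign of [iota_act]; this doubling gives
     the [e] in the witness. *)
  rewrite -!exprzDr //; apply/esym; set e := eps [set i] (J :\: _).
  by apply: (@exprz_mod2 _ _ (e%:Z + 1)); lia.
have -> : W :\ i = set0 by apply/eqP; rewrite -cards_eq0 Wil l0.
rewrite eps_set0 mulr1 mul1r l0; apply/esym.
set e := eps [set i] (J :\: _).
by apply: (@exprz_mod2 _ _ (e%:Z + p + 1)); lia.
Qed.

End Signs.

(** * Degeneration of the Mayer-Vietoris double complex *)

Section MayerVietorisDegeneration.
Variables (k : fieldType) (m : nat) (K : {set {set 'I_m}}).
Hypothesis simpK : simplicial_complex K.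
Implicit Types (I J U V W : {set 'I_m}) (p q : int).

Local Notation zigzag I J :=
  (zigzag (mv_term k K I J) (linfun (mv_horiz K J))
     (fun p q => linfun (mv_vert K I J p q))).
Local Notation mv_boundaries I J :=
  (page_boundaries (mv_term k K I J) (linfun (mv_horiz K J))
     (fun p q => linfun (mv_vert K I J p q))).

Lemma linfun_mv_vert_term I J p q (w : cochain_family k m) :
  w \in mv_term k K I J p q ->
  linfun (mv_vert K I J p q) w \in mv_term k K I J p (q + 1).
Proof. by rewrite lfunE; exact: mv_vert_term. Qed.

Lemma linfun_mv_vertK I J p q (w : cochain_family k m) :
  w \in mv_term k K I J p q ->
  linfun (mv_vert K I J p (q + 1)) (linfun (mv_vert K I J p q) w) = 0.
Proof.
move=> _; rewrite !lfunE /= /mv_vert.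
by case: ifP => _; case: ifP => _; rewrite ?linearZ /= cechK ?scaler0.
Qed.

(** In a fixed row the vertical map depends on [p] only through a sign. As each vertical map
    commutes with [mv_horiz], this yields the relations up to a scalar required by the general
    lemmas on double complexes. *)
Lemma mv_vert_scale I J p p' q : exists e : k, forall w : cochain_family k m,
  mv_vert K I J p q w = e *: mv_vert K I J p' q w.
Proof.
have [q1|q1] := boolP (q == -1).
  by exists 1 => w; rewrite /mv_vert q1 scale1r.
exists ((-1) ^ p / (-1) ^ p') => w; rewrite /mv_vert (negPf q1) scalerA divfK //.
by rewrite expfz_neq0 // oppr_eq0 oner_eq0.
Qed.

Lemma mv_horiz_vert I J p q (w : cochain_family k m) :
  mv_horiz K J (mv_vert K I J p q w) = mv_vert K I J p q (mv_horiz K J w).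
Proof.
by rewrite /mv_vert; case: ifP => _; rewrite ?linearZ /= mv_horiz_cech.
Qed.

Lemma linfun_mv_hv I J p q : exists e : k, forall w, w \in mv_term k K I J p q ->
  linfun (mv_horiz K J) (linfun (mv_vert K I J p q) w) =
  e *: linfun (mv_vert K I J (p + 1) q) (linfun (mv_horiz K J) w).
Proof.
have [e he] := mv_vert_scale I J p (p + 1) q.
by exists e => w _; rewrite !lfunE /= mv_horiz_vert he.
Qed.

Lemma linfun_mv_vh I J p q : exists e : k, forall w, w \in mv_term k K I J p q ->
  linfun (mv_vert K I J (p + 1) q) (linfun (mv_horiz K J) w) =
  e *: linfun (mv_horiz K J) (linfun (mv_vert K I J p q) w).
Proof.
have [e he] := mv_vert_scale I J (p + 1) p q.
by exists e => w _; rewrite !lfunE /= mv_horiz_vert he.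
Qed.

Lemma mv_indexE I J l W :
  mv_index I J (-1 + l%:Z) W = (W \subset I :&: J) && (#|W| == l).
Proof. by rewrite /mv_index; congr (_ && _); lia. Qed.

(** The horizontal differential acts at each index separately, so this and [mv_boundaries1P] exhibit
    the first page as a direct sum of reduced cohomology groups. *)
Lemma mv_cycles1P I J p q (w : cochain_family k m) : reflect
  (forall W, if mv_index I J q W
             then is_true (w W \in cocycles k p (full_sub K (J :\: W)))
             else w W = 0)
  (w \in mv_cycles k K I J 1 p q).
Proof.
rewrite /mv_cycles /page_cycles memv_cap memv_ker lfunE.
apply: (iffP andP) => [[/eqP/ffunP dw /mv_termP wD] W|wP].
  have := wD W; case: ifP => // _ wW; rewrite memv_cap wW memv_ker lfunE /=.
  by have := dw W; rewrite !ffunE => ->.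
split; last first.
  by apply/mv_termP => W; have := wP W; case: ifP => //; rewrite memv_cap => _ /andP[].
apply/eqP/ffunP => W; rewrite !ffunE; have := wP W; case: ifP => [_|_ ->].
  by rewrite memv_cap memv_ker lfunE => /andP[_ /eqP].
exact: linear0.
Qed.

Lemma mv_boundaries1P I J p q (w : cochain_family k m) : reflect
  (forall W, if mv_index I J q W
             then is_true (w W \in coboundaries k p (full_sub K (J :\: W)))
             else w W = 0)
  (w \in mv_boundaries I J 1 p q).
Proof.
rewrite /page_boundaries /= addv0.
apply: (iffP memv_imgP) => [[y /mv_termP yD ->] W|wP].
  have := yD W; rewrite lfunE ffunE; case: ifP => _ yW; last by rewrite yW linear0.
  by apply/memv_imgP; exists (y W); rewrite // lfunE.
have /choice[g gP] : forall W, exists f : cochain k m,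
    if mv_index I J q W then f \in cochains k (p - 1) (full_sub K (J :\: W)) /\
      w W = cobound (full_sub K (J :\: W)) f else f = 0 /\ w W = 0.
  move=> W; have := wP W; case: ifP => _; last by exists 0.
  move=> /memv_imgP[f fC ->].
  by exists f; rewrite lfunE.
exists [ffun W => g W].
  by apply/mv_termP => W; rewrite ffunE; have := gP W; case: ifP => _ [].
apply/ffunP => W; rewrite lfunE !ffunE.
by have := gP W; case: ifP => _ [] // -> ->; rewrite linear0.
Qed.

(** The form in which the vanishing of the differentials before page [s] is used: horizontal
    cocycles start zigzags of length [s]. A statement about cycles can be transferred from [I] to a
    subset. *)
Definition mv_degenerate s I J := forall p q,
  (mv_cycles k K I J 1 p q <= mv_cycles k K I J s p q)%VS.

Lemma mv_diff0_degenerate s I J :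
  (forall r, (1 <= r < s)%N ->
     forall p q (xi : mv_page k K I J r p q), mv_diff xi = 0) ->
  mv_degenerate s I J.
Proof.
move=> dr0 p q; apply: page_cycles_degenerate dr0.
- exact: linfun_mv_vert_term.
- exact: linfun_mv_vertK.
- exact: linfun_mv_hv.
- exact: linfun_mv_vh.
Qed.

Lemma mv_boundaries_degenerate s I J : mv_degenerate s I J ->
  forall r p q, (r < s)%N ->
  (mv_boundaries I J r.+1 p q <= mv_boundaries I J 1 p q)%VS.
Proof.
apply: page_boundaries_degenerate.
- exact: linfun_mv_vert_term.
- exact: linfun_mv_vertK.
- exact: linfun_mv_vh.
Qed.

Lemma mv_boundaries1S s I J p q :
  (mv_boundaries I J 1 p q <= mv_boundaries I J s p q)%VS.
Proof. by rewrite /page_boundaries /= addv0 addvSl. Qed.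

Lemma mv_cycles_sub1 s I J p q : (0 < s)%N ->
  (mv_cycles k K I J s p q <= mv_cycles k K I J 1 p q)%VS.
Proof.
move=> s0; apply/subvP => w /(@page_cyclesP _ _ _ _ _ _ _ _ _ s0)[x <- zx].
by apply/page_cyclesP => //; exists x => //; exact: zigzagW zx.
Qed.

Lemma mv_cycles1E s I J p q : (0 < s)%N -> mv_degenerate s I J ->
  mv_cycles k K I J s p q = mv_cycles k K I J 1 p q.
Proof. by move=> s0 degs; apply/eqP; rewrite eqEsubv degs mv_cycles_sub1. Qed.

(* Extend a family over subsets of V by zero, continue its zigzag over I, and
   restrict it back to the subsets of V. *)
Lemma mv_degenerateS s I V J : V \subset I -> (0 < s)%N ->
  mv_degenerate s I J -> mv_degenerate s V J.
Proof.
move=> VI s0 degs p q; apply/subvP => w /mv_cycles1P wV.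
have VIJ W : W \subset V :&: J -> W \subset I :&: J.
  by move/subset_trans; apply; exact: setSI.
have : w \in mv_cycles k K I J 1 p q.
  apply/mv_cycles1P => W; have := wV W; rewrite /mv_index.
  case: (boolP (W \subset V :&: J)) => [/VIJ ->//|_ /= ->].
  by case: ifP => _; rewrite ?mem0v.
move=> /(subvP (degs _ _))/(@page_cyclesP _ _ _ _ _ _ _ _ _ s0)[x x0 [xD dx0 dx]].
apply/page_cyclesP => //.
exists (fun l => [ffun W : {set 'I_m} => if W \subset V :&: J then x l W else 0]
         : cochain_family k m).
  apply/ffunP => W; rewrite ffunE x0; have := wV W; rewrite /mv_index.
  by case: (W \subset _).
split=> [l ls||l ls].
- apply/mv_termP => W; have /mv_termP/(_ W) := xD l ls.
  rewrite ffunE /mv_index; case: (boolP (W \subset V :&: J)) => [/VIJ ->|] //=.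
- apply/ffunP => W; move/ffunP/(_ W): dx0; rewrite !lfunE /= !ffunE.
  by case: ifP => // _ _; rewrite linear0.
apply/ffunP => W; have /ffunP/(_ W) := dx l ls; rewrite !lfunE /= /mv_vert.
move: (q + _) => q'; move: (p - _) => p'.
(* Off the subsets of [V] both sides vanish. For [W] inside [V] the Čech sum only involves the sets
   [W :\ i], again inside [V], so the truncation does not affect it. *)
have [WV|/negPf WV] := boolP (W \subset V :&: J); last first.
  by move=> _; case: ifP => _; rewrite !ffunE WV linear0 ?scaler0.
case: ifP => _; rewrite !ffunE WV (VIJ _ WV) => ->; last congr (_ *: _);
  by apply: eq_bigr => i iW; rewrite ffunE (subset_trans (subD1set _ _) WV).
Qed.

(** * Zigzags from row -1 and defining systems *)

Lemma zigzag_defining_system I J p s V x : V \subset I :&: J -> #|V| = s ->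
  zigzag I J s p (-1) x ->
  defining_system K J p V (x 0%N set0)
    (fun W => zig_sign k J p W *: x #|W| W).
Proof.
move=> VIJ Vs [xD _ dx]; split=> [|W WV|W W0 WV].
- by rewrite /zig_sign eqxx cards0 scale1r.
- have ls : (#|W| < s)%N by rewrite -Vs proper_card.
  have /mv_termP/(_ W) := xD _ ls.
  by rewrite mv_indexE eqxx (subset_trans (proper_sub WV) VIJ) => /memvZ.
have [l Wl] : exists l, #|W| = l.+1.
  by exists #|W|.-1; rewrite prednK // card_gt0.
have ls : (l.+1 < s)%N by rewrite -Wl -Vs proper_card.
(* For [W] with [l + 1] elements, the component at [W] of the zigzag equation from [x l] to [x l.+1]
   is the defining equation at [W], once the signs, which square to 1, are removed. *)
move/ffunP/(_ W): (dx l ls); rewrite !lfunE /= ffunE => e.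
rewrite linearZ /= Wl e (@mv_vert_iota _ _ _ _ _ _ _ _ _ (fun W => zig_sign k J p W *: x #|W| W)) //.
- by rewrite scalerA zig_sign_sqr scale1r.
- exact: subset_trans (proper_sub WV) VIJ.
- move=> i iW; rewrite scalerA zig_sign_sqr scale1r.
  by have := cardsD1 i W; rewrite iW Wl add1n => -[<-].
Qed.

(** Inverse passage: the members of cardinality [l] form one family. It is cut off outside [V],
    where a defining system says nothing about [a]. *)
Definition defsys_zigzag J p V (a : {set 'I_m} -> cochain k m) (l : nat) :
    cochain_family k m :=
  [ffun W : {set 'I_m} => if (W \subset V) && (#|W| == l)
                          then zig_sign k J p W *: a W else 0].

(** Over the cover indexed by [V] the indices in row [l - 1] are the [l]-element subsets of [V]. For
    [l] below [#|V|] they are proper subsets, exactly those governed by the defining system. *)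
Lemma defsys_zigzagP J p V alpha a : V \subset J ->
  alpha \in cocycles k p (full_sub K J) ->
  defining_system K J p V alpha a ->
  zigzag V J #|V| p (-1) (defsys_zigzag J p V a).
Proof.
move=> VJ + [a0 aC da]; rewrite memv_cap memv_ker lfunE => /andP[alphaC /eqP dalpha].
have VJV : V :&: J = V by apply/setIidPl.
have xD l : (l < #|V|)%N ->
    defsys_zigzag J p V a l \in mv_term k K V J (p - l%:Z) (-1 + l%:Z).
  move=> lV; apply/mv_termP => W; rewrite mv_indexE VJV ffunE.
  case: ifP => cW; rewrite cW //; case/andP: cW => WV /eqP Wl.
  rewrite memvZ // -Wl aC //.
  by rewrite properEcard WV Wl.
split=> [//||l lV].
  apply/ffunP => W; rewrite lfunE !ffunE.
  case: ifP => [/andP[_]|_]; last exact: linear0.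
  by rewrite cards_eq0 => /eqP ->; rewrite linearZ /= a0 setD0 dalpha scaler0.
apply/ffunP => W; rewrite !lfunE /= [LHS]ffunE [X in cobound _ X]ffunE.
case: ifP => [/andP[WV /eqP Wl]|WV].
  rewrite (@mv_vert_iota _ _ _ _ _ _ _ _ _ a) ?VJV //; last first.
    move=> i iW; rewrite ffunE (subset_trans (subD1set _ _) WV).
    by have := cardsD1 i W; rewrite iW Wl add1n => -[<-]; rewrite eqxx.
  rewrite linearZ /= da //; first by rewrite -cards_eq0 Wl.
  by rewrite properEcard WV Wl.
(* At a set that is not an index the left side is 0 by construction, and the right side is 0 because
   it is a component of an element of row [l]. *)
have /mv_termP/(_ W) := mv_vert_term (xD l (ltnW lV)).
have -> : -1 + l%:Z + 1 = -1 + l.+1%:Z :> int by lia.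
by rewrite mv_indexE VJV WV linear0.
Qed.

Lemma iota_sumB J p W (a b : {set 'I_m} -> cochain k m) :
  iota_sum K J p W (a \- b) = iota_sum K J p W a - iota_sum K J p W b.
Proof.
rewrite /iota_sum -sumrB; apply: eq_bigr => i _; rewrite /iota_act.
by case: ifP => _; rewrite ?subrr // linearB scalerBr.
Qed.

Lemma defining_systemB J p V alpha beta (a b : {set 'I_m} -> cochain k m) :
  defining_system K J p V alpha a -> defining_system K J p V beta b ->
  defining_system K J p V (alpha - beta) (a \- b).
Proof.
move=> [<- aC da] [<- bC db]; split=> // [W WV|W W0 WV].
  by rewrite memvB ?aC ?bC.
by rewrite linearB /= iota_sumB da ?db.
Qed.

Lemma defsys_zigzag_vert J p V (a : {set 'I_m} -> cochain k m) :
  V \subset J -> (0 < #|V|)%N ->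
  mv_vert K V J (p - #|V|.-1%:Z) (-1 + #|V|.-1%:Z) (defsys_zigzag J p V a #|V|.-1) V =
  zig_sign k J p V *: iota_sum K J p V a.
Proof.
move=> VJ V0; apply: mv_vert_iota; rewrite ?prednK //.
  by rewrite subsetI subxx.
move=> i iV; rewrite ffunE subD1set.
by have := cardsD1 i V; rewrite iV add1n => ->; rewrite eqxx.
Qed.

Section DefiningSystem.
Variables (J V : {set 'I_m}) (p : int) (alpha : cochain k m).
Variable a : {set 'I_m} -> cochain k m.
Hypotheses (VJ : V \subset J) (V0 : (0 < #|V|)%N).
Hypothesis alphaZ : alpha \in cocycles k p (full_sub K J).
Hypothesis ha : defining_system K J p V alpha a.

Let idxV l W : mv_index V J (-1 + l%:Z) W = (W \subset V) && (#|W| == l).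
Proof. by rewrite mv_indexE (setIidPl VJ). Qed.

(** Up to sign the sum is the component at [V] of the last vertical differential of the associated
    zigzag, which is a page cycle and hence horizontally closed. *)
Lemma iota_sum_cocycle :
  iota_sum K J p V a \in cocycles k (p - #|V|%:Z + 1) (full_sub K (J :\: V)).
Proof.
have := @zigzag_last_cycle _ _ _ _ _ (@linfun_mv_vert_term V J)
  (@linfun_mv_vertK V J) (@linfun_mv_hv V J) _ _ _ _ V0 (defsys_zigzagP VJ alphaZ ha).
move=> /(subvP (mv_cycles_sub1 _ _ _ _ V0))/mv_cycles1P/(_ V).
rewrite idxV subxx eqxx /= lfunE /= defsys_zigzag_vert //.
by move/(memvZ (zig_sign k J p V)); rewrite scalerA zig_sign_sqr scale1r.
Qed.

(** The associated zigzag now starts at a boundary, so [zigzag_indeterminacy] puts its last vertical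
    differential among the boundaries of page [#|V|]; by degeneration these are horizontal
    coboundaries. *)
Lemma iota_sum_coboundary : mv_degenerate #|V| V J ->
  alpha \in coboundaries k p (full_sub K J) ->
  iota_sum K J p V a
    \in coboundaries k (p - #|V|%:Z + 1) (full_sub K (J :\: V)).
Proof.
move=> degV alphaB; have [a0 _ _] := ha.
have := zigzag_indeterminacy (@linfun_mv_vert_term V J)
  (@linfun_mv_vertK V J) (@linfun_mv_vh V J) V0 (defsys_zigzagP VJ alphaZ ha).
have x0B : defsys_zigzag J p V a 0 \in mv_boundaries V J #|V| p (-1).
  apply: (subvP (mv_boundaries1S _ _ _ _ _)); apply/mv_boundaries1P => W.
  rewrite -[-1](addr0 (-1)) idxV ffunE; case: ifP => cW; rewrite cW //.
  by case/andP: cW => _; rewrite cards_eq0 => /eqP ->; rewrite a0 setD0 memvZ.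
have l1 : (#|V|.-1 < #|V|)%N by rewrite prednK.
have := @mv_boundaries_degenerate _ _ _ degV _ (p - #|V|%:Z + 1) (-1 + #|V|%:Z) l1.
rewrite prednK // => /subvP h /(_ x0B)/h/mv_boundaries1P/(_ V).
rewrite idxV subxx eqxx /= lfunE /= defsys_zigzag_vert //.
by move/(memvZ (zig_sign k J p V)); rewrite scalerA zig_sign_sqr scale1r.
Qed.

End DefiningSystem.

End MayerVietorisDegeneration.

(** * Identification of page [s] with reduced cohomology, and its differential *)

Section Component.
Variables (k : fieldType) (m : nat) (W : {set 'I_m}).

Definition component (w : cochain_family k m) : cochain k m := w W.

Fact component_is_linear : linear component.
Proof. by move=> a f g; rewrite /component !ffunE. Qed.
HB.instance Definition _ := GRing.isSemilinear.Build k (cochain_family k m)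
  (cochain k m) _ component (GRing.semilinear_linear component_is_linear).

End Component.

Section MayerVietorisPages.
Variables (k : fieldType) (m : nat) (K : {set {set 'I_m}}) (I J : {set 'I_m}).
Variables (s : nat) (p : int).
Hypotheses (simpK : simplicial_complex K) (s0 : (0 < s)%N).
Hypothesis degs : mv_degenerate k K s I J.

Local Notation mv_boundaries :=
  (page_boundaries (mv_term k K I J) (linfun (mv_horiz K J))
     (fun p q => linfun (mv_vert K I J p q)) s).

Lemma mv_boundariesP p' q (w : cochain_family k m) : reflect
  (forall W, if mv_index I J q W
             then is_true (w W \in coboundaries k p' (full_sub K (J :\: W)))
             else w W = 0)
  (w \in mv_boundaries p' q).
Proof.
apply: (iffP idP) => [|/mv_boundaries1P]; last first.
  by apply: subvP; exact: mv_boundaries1S.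
have s1 : (s.-1 < s)%N by rewrite prednK.
have := @mv_boundaries_degenerate _ _ _ simpK _ _ _ degs s.-1 p' q s1.
by rewrite prednK // => /subvP h /h/mv_boundaries1P.
Qed.

Lemma mv_index_row0 W : mv_index I J (-1) W = (W == set0).
Proof.
rewrite -[-1](addr0 (-1)) mv_indexE cards_eq0.
by case: eqVneq => [->|]; rewrite ?sub0set ?andbF.
Qed.

(** The empty set is the only index in row -1, so [single set0] matches cocycles with page cycles
    and coboundaries with page boundaries; the equivalence [fB] gives injectivity, and the component
    at the empty set gives preimages. *)
Lemma mv_page_augmentation_iso :
  exists phi : {linear rcohom k p (full_sub K J) -> mv_page k K I J s p (-1)},
    bijective phi /\
    forall alpha, alpha \in cocycles k p (full_sub K J) ->
      phi (rcohom_cls p (full_sub K J) alpha) =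
      mv_cls K I J s p (-1) (single set0 alpha).
Proof.
pose f : {linear cochain k m -> cochain_family k m} := single set0.
have fZ alpha : alpha \in cocycles k p (full_sub K J) ->
    f alpha \in mv_cycles k K I J s p (-1).
  move=> alphaZ; apply: (subvP (degs _ _)); apply/mv_cycles1P => W.
  by rewrite mv_index_row0 ffunE; case: eqVneq => // ->; rewrite setD0.
have fB alpha : alpha \in coboundaries k p (full_sub K J) <->
    f alpha \in mv_boundaries p (-1).
  split=> [alphaB|/mv_boundariesP/(_ set0)].
    apply/mv_boundariesP => W; rewrite mv_index_row0 ffunE.
    by case: eqVneq => // ->; rewrite setD0.
  by rewrite mv_index_row0 ffunE eqxx setD0.
pose phi := @subquot_lmap k _ _ (cocycles k p (full_sub K J))
  (coboundaries k p (full_sub K J)) (mv_cycles k K I J s p (-1))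
  (mv_boundaries p (-1)) f fZ (fun a _ => (fB a).1).
have phiE alpha : alpha \in cocycles k p (full_sub K J) ->
    phi (cls _ _ alpha) = cls (mv_cycles k K I J s p (-1)) (mv_boundaries p (-1)) (f alpha).
  exact: subquot_lmapE.
exists phi; split=> //; apply: inj_surj_bijective => [xi eta|eta].
  have [x xZ <-] := cls_surj xi; have [y yZ <-] := cls_surj eta.
  rewrite !phiE // => /cls_eq e; apply/cls_eq => //; apply/fB.
  by rewrite linearB; apply: e; rewrite fZ.
have [w wZ <-] := cls_surj eta.
have /mv_cycles1P wP : w \in mv_cycles k K I J 1 p (-1).
  by apply: subvP wZ; exact: mv_cycles_sub1.
have w0Z : w set0 \in cocycles k p (full_sub K J).
  by have := wP set0; rewrite mv_index_row0 eqxx setD0.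
exists (cls _ _ (w set0)); rewrite phiE //; congr (cls _ _ _).
apply/ffunP => W; rewrite ffunE; have := wP W; rewrite mv_index_row0.
by case: eqVneq => [->|_ ->].
Qed.

Local Notation row_index := {V : {set 'I_m} | (V \subset I :&: J) && (#|V| == s)}.

(** The maps are the projections to components. They are jointly injective because page boundaries
    are recognised componentwise by [mv_boundariesP]. *)
Lemma mv_page_row_iso q : q = -1 + s%:Z ->
  exists psi : forall V : row_index,
      {linear mv_page k K I J s p q -> rcohom k p (full_sub K (J :\: val V))},
    bijective (fun eta : mv_page k K I J s p q =>
      [ffun V => psi V eta] : {dffun forall V : row_index,
         rcohom k p (full_sub K (J :\: val V))}) /\
    forall w, w \in mv_cycles k K I J s p q ->
      forall V, psi V (mv_cls K I J s p q w) =
        rcohom_cls p (full_sub K (J :\: val V)) (w (val V)).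
Proof.
move=> qE.
have idx (V : row_index) : mv_index I J q (val V) by rewrite qE mv_indexE (valP V).
pose f (V : row_index) : {linear cochain_family k m -> cochain k m} :=
  component (val V).
have fZ V w : w \in mv_cycles k K I J s p q ->
    f V w \in cocycles k p (full_sub K (J :\: val V)).
  by rewrite mv_cycles1E // => /mv_cycles1P/(_ (val V)); rewrite idx.
have fB V w : w \in mv_cycles k K I J s p q -> w \in mv_boundaries p q ->
    f V w \in coboundaries k p (full_sub K (J :\: val V)).
  by move=> _ /mv_boundariesP/(_ (val V)); rewrite idx.
pose psi V := @subquot_lmap k _ _ (mv_cycles k K I J s p q) (mv_boundaries p q)
  (cocycles k p (full_sub K (J :\: val V)))
  (coboundaries k p (full_sub K (J :\: val V))) (f V) (fZ V) (fB V).
have psiE V w : w \in mv_cycles k K I J s p q ->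
    psi V (cls _ _ w) = cls (cocycles k p (full_sub K (J :\: val V)))
      (coboundaries k p (full_sub K (J :\: val V))) (w (val V)).
  exact: subquot_lmapE.
exists psi; split=> [|w wZ V]; last exact: psiE.
apply: inj_surj_bijective => [xi eta|g].
  have [x xZ <-] := cls_surj xi; have [y yZ <-] := cls_surj eta.
  move=> /ffunP e; apply/cls_eq => //; apply/mv_boundariesP => W.
  have /mv_cycles1P/(_ W) : x - y \in mv_cycles k K I J 1 p q.
    by apply: subvP (memvB xZ yZ); exact: mv_cycles_sub1.
  case: (boolP (mv_index I J q W)) => // + _.
  rewrite qE mv_indexE => Wi; have := e (exist _ W Wi); rewrite !ffunE !psiE //=.
  move/cls_eq => -> //; exact: (fZ (exist _ W Wi)).
(* A preimage is assembled from chosen cocycle representatives, with 0 at every set that is not an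
   index. *)
pose w : cochain_family k m :=
  [ffun W => oapp (fun V : row_index => vsval (repr (g V))) 0 (insub W)].
have wE V : w (val V) = vsval (repr (g V)) by rewrite ffunE valK.
have wZ : w \in mv_cycles k K I J s p q.
  rewrite mv_cycles1E //; apply/mv_cycles1P => W; rewrite qE mv_indexE.
  case: ifP => Wi; last by rewrite ffunE insubF.
  by rewrite -[W]/(val (exist _ W Wi : row_index)) wE; exact: subvsP.
exists (cls _ _ w).
by apply/ffunP => V; rewrite ffunE psiE // wE cls_vsval reprK.
Qed.

(** The differential is a chosen element of a graph; [mv_diffP] makes the graph a singleton, so
    every zigzag computes it. *)
Lemma mv_diffE x : zigzag (mv_term k K I J) (linfun (mv_horiz K J))
    (fun p q => linfun (mv_vert K I J p q)) s p (-1) x ->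
  mv_diff (mv_cls K I J s p (-1) (x 0%N)) =
  mv_cls K I J s (p - s%:Z + 1) (-1 + s%:Z)
    (mv_vert K I J (p - s.-1%:Z) (-1 + s.-1%:Z) (x s.-1)).
Proof.
move=> zx; set eta := RHS.
have : [set e | page_diff_graph (mv_cls K I J s p (-1) (x 0%N)) e]%classic eta.
  by exists x; rewrite lfunE.
by rewrite mv_diffP.
Qed.

Lemma mv_vert_cycle x : zigzag (mv_term k K I J) (linfun (mv_horiz K J))
    (fun p q => linfun (mv_vert K I J p q)) s p (-1) x ->
  mv_vert K I J (p - s.-1%:Z) (-1 + s.-1%:Z) (x s.-1)
    \in mv_cycles k K I J s (p - s%:Z + 1) (-1 + s%:Z).
Proof.
move=> zx; have := @zigzag_last_cycle _ _ _ _ _ (@linfun_mv_vert_term _ _ K I J)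
  (@linfun_mv_vertK _ _ K I J) (@linfun_mv_hv _ _ K simpK I J) _ _ _ _ s0 zx.
by rewrite lfunE.
Qed.

(** The difference of the two defining systems is a defining system for a coboundary. Degeneration
    is first transferred from [I] to [V], since the associated zigzag lives over [V]. *)
Lemma higher_op_unique (V : {set 'I_m}) alpha beta a b : V \subset I :&: J -> #|V| = s ->
  alpha \in cocycles k p (full_sub K J) -> beta \in cocycles k p (full_sub K J) ->
  rcohom_cls p (full_sub K J) alpha = rcohom_cls p (full_sub K J) beta ->
  defining_system K J p V alpha a -> defining_system K J p V beta b ->
  rcohom_cls (p - s%:Z + 1) (full_sub K (J :\: V)) (iota_sum K J p V a) =
  rcohom_cls (p - s%:Z + 1) (full_sub K (J :\: V)) (iota_sum K J p V b).
Proof.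
move=> VIJ Vs alphaZ betaZ /cls_eq eab ha hb.
have [VI VJ] : V \subset I /\ V \subset J by apply/andP; rewrite -subsetI.
have abB : alpha - beta \in coboundaries k p (full_sub K J) by exact: eab.
have V0 : (0 < #|V|)%N by rewrite Vs.
have degV : mv_degenerate k K #|V| V J.
  by rewrite Vs; exact: (mv_degenerateS VI s0 degs).
rewrite -Vs; apply/cls_eq.
- exact: (iota_sum_cocycle simpK VJ V0 alphaZ ha).
- exact: (iota_sum_cocycle simpK VJ V0 betaZ hb).
rewrite -iota_sumB.
exact: (iota_sum_coboundary simpK VJ V0 (memvB alphaZ betaZ)
  (defining_systemB ha hb) degV abB).
Qed.

End MayerVietorisPages.

(** * Comparison of the differential on row -1 with the higher operations *)

Theorem lemma6p6 (k : fieldType) (m : nat) (K : {set {set 'I_m}})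
    (I J : {set 'I_m}) (s : nat) (p : int) :
  simplicial_complex K -> (1 <= s)%N ->
  (forall r : nat, (1 <= r < s)%N ->
     forall (p' q' : int) (xi : mv_page k K I J r p' q'), mv_diff xi = 0) ->
  exists (phi : {linear rcohom k p (full_sub K J) ->
                        mv_page k K I J s p (-1)})
         (psi : forall V : {V : {set 'I_m} | (V \subset I :&: J) && (#|V| == s)},
            {linear mv_page k K I J s (p - s%:Z + 1) (-1 + s%:Z) ->
                    rcohom k (p - s%:Z + 1) (full_sub K (J :\: val V))}),
  [/\ bijective phi,
      bijective (fun eta : mv_page k K I J s (p - s%:Z + 1) (-1 + s%:Z) =>
        [ffun V => psi V eta]
        : {dffun forall V : {V : {set 'I_m} | (V \subset I :&: J) && (#|V| == s)},
             rcohom k (p - s%:Z + 1) (full_sub K (J :\: val V))}),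
      forall alpha, alpha \in cocycles k p (full_sub K J) ->
        phi (rcohom_cls p (full_sub K J) alpha) =
        mv_cls K I J s p (-1) (single set0 alpha),
      forall w, w \in mv_cycles k K I J s (p - s%:Z + 1) (-1 + s%:Z) ->
        forall V, psi V (mv_cls K I J s (p - s%:Z + 1) (-1 + s%:Z) w) =
          rcohom_cls (p - s%:Z + 1) (full_sub K (J :\: val V)) (w (val V))
    & forall xi V, exists2 eta,
        higher_op s (val V) xi = [set eta]%classic
      & psi V (mv_diff (phi xi)) =
        (-1) ^ ((eps (val V) J)%:Z + p + s%:Z) *: eta].
Proof.
move=> simpK s0 dr0; have degs := mv_diff0_degenerate simpK dr0.
have [phi [phi_bij phiE]] := mv_page_augmentation_iso p simpK s0 degs.
have [psi [psi_bij psiE]] := mv_page_row_iso (p - s%:Z + 1) simpK s0 degs (erefl _).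
exists phi, psi; split=> // xi V.
have /andP[VIJ /eqP Vs] := valP V.
have [alpha alphaZ cl_alpha] := cls_surj xi.
have w0Z : single set0 alpha \in mv_cycles k K I J 1 p (-1).
  apply/mv_cycles1P => W; rewrite mv_index_row0 ffunE.
  by case: eqVneq => // ->; rewrite setD0.
have /(@page_cyclesP _ _ _ _ _ _ _ _ _ s0)[x x0 zx] := subvP (degs p (-1)) _ w0Z.
(* One zigzag serves both purposes: it computes the differential, and after rescaling it is a
   defining system whose value is the witness [eta]. *)
pose a W := zig_sign k J p W *: x #|W| W.
have ha : defining_system K J p (val V) alpha a.
  by have := zigzag_defining_system VIJ Vs zx; rewrite x0 ffunE eqxx.
exists (rcohom_cls (p - s%:Z + 1) (full_sub K (J :\: val V)) (iota_sum K J p (val V) a)).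
  apply/seteqP; split=> [eta [beta [b [betaZ eab hb ->]]]|_ ->]; last by exists alpha, a.
  apply: (higher_op_unique simpK s0 degs VIJ Vs betaZ alphaZ _ hb ha).
  by rewrite eab -cl_alpha.
rewrite -cl_alpha [phi _]phiE // -x0 mv_diffE // psiE; last exact: mv_vert_cycle.
rewrite (@mv_vert_iota _ _ _ _ _ _ _ _ _ a) ?prednK //; last first.
  move=> i iV; rewrite scalerA zig_sign_sqr scale1r.
  by have /(congr1 predn) := cardsD1 i (val V); rewrite iV Vs => ->.
(* As [s] is positive, [val V] is nonempty, so [zig_sign] takes its general branch, with exponent
   [eps (val V) J + p + s]. *)
by rewrite linearZ /= /zig_sign -cards_eq0 Vs eqn0Ngt s0.
Qed.
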